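(* Let $\Bbbk$ be a field of characteristic zero. The Freiheitssatz holds for the variety of generic Poisson algebras over $\Bbbk$; that is: let $X=\{x_1,x_2,\dots\}$ be a countable set, let $x\notin X$, and let $\operatorname{GP}(X)\subset \operatorname{GP}(X\cup\{x\})$ be the free generic Poisson algebras generated by $X$ and by $X\cup\{x\}$. Then for every $f\in \operatorname{GP}(X\cup\{x\})\setminus \operatorname{GP}(X)$ the ideal $(f)$ of $\operatorname{GP}(X\cup\{x\})$ generated by $f$ satisfies $(f)\cap \operatorname{GP}(X)=0$.
   Context: A generic Poisson algebra (GP-algebra) over $\Bbbk$ is a $\Bbbk$-linear space with a bilinear associative and commutative product $x\cdot y=xy$, a bilinear anti-commutative bracket $\{x,y\}$ (no Jacobi identity is required), and a multiplicative identity $1$ (a constant in the signature), satisfying the Leibniz identity $\{x,yz\}=\{x,y\}z+\{x,z\}y$. GP-algebras form a variety; $\operatorname{GP}(X)$ denotes the free GP-algebra generated by $X$. An ideal of a GP-algebra $A$ is a linear subspace $I$ with $AI\subseteq I$ and $\{A,I\}\subseteq I$. *)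

(* Defs.v *)
From HB Require Import structures.
From mathcomp Require Import all_boot all_algebra ring.
From mathcomp Require Import boolp classical_sets.

Set Implicit Arguments.
Unset Strict Implicit.
Unset Printing Implicit Defensive.

Import GRing.Theory.
Local Open Scope ring_scope.
Local Open Scope quotient_scope.

(* [comAlgType] excludes the zero algebra. This affects neither [GP] below,
   which is built from the identities alone and shown to be nonzero, nor its
   universal property, which is trivial for maps to the zero algebra. *)
HB.mixin Record isGenericPoisson (K : fieldType) A of GRing.ComAlgebra K A := {
  bracket : A -> A -> A;
  bracket_linearl : forall y, linear (bracket^~ y);
  bracket_linearr : forall x, linear (bracket x);
  bracketC : forall x y, bracket x y = - bracket y x;
  bracketMr : forall x y z,
    bracket x (y * z) = bracket x y * z + bracket x z * y
}.

#[short(type="gpAlgType")]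
HB.structure Definition GPAlgebra (K : fieldType) :=
  {A of GRing.ComAlgebra K A & isGenericPoisson K A}.

Section Ideals.
Variables (K : fieldType) (A : gpAlgType K).

Record gp_ideal (I : set A) : Prop := GpIdeal {
  gp_ideal0 : I 0;
  gp_idealP : forall (a : K) u v, I u -> I v -> I (a *: u + v);
  gp_idealM : forall u v, I v -> I (u * v);
  gp_idealB : forall u v, I v -> I (bracket u v)
}.

Definition ideal_gen (f : A) : set A := smallest gp_ideal [set f]%classic.

Lemma gp_ideal_gen f : gp_ideal (ideal_gen f).
Proof.
split=> [|a u v Iu Iv|u v Iv|u v Iv] J [idJ fJ] /=.
- exact: gp_ideal0.
- by apply: gp_idealP => //; [apply: Iu | apply: Iv].
- by apply: gp_idealM => //; apply: Iv.
- by apply: gp_idealB => //; apply: Iv.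
Qed.

End Ideals.

(* The free algebra on [X] is the term algebra of the signature modulo the
   fully invariant congruence generated by the defining identities. *)

Inductive term (K X : Type) : Type :=
  | TVar of X
  | TZero
  | TOne
  | TOpp of term K X
  | TScale of K & term K X
  | TAdd of term K X & term K X
  | TMul of term K X & term K X
  | TBr of term K X & term K X.

Arguments TVar {K X}.
Arguments TZero {K X}.
Arguments TOne {K X}.

HB.instance Definition _ (K X : Type) := gen_eqMixin (term K X).
HB.instance Definition _ (K X : Type) := gen_choiceMixin (term K X).

Section Free.
Variables (K : fieldType) (X : Type).
Local Notation T := (term K X).

Inductive gp_eq : T -> T -> Prop :=
  | gp_refl t : gp_eq t t
  | gp_sym s t : gp_eq s t -> gp_eq t s
  | gp_trans s t u : gp_eq s t -> gp_eq t u -> gp_eq s u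
  | gp_congN s t : gp_eq s t -> gp_eq (TOpp s) (TOpp t)
  | gp_congZ a s t : gp_eq s t -> gp_eq (TScale a s) (TScale a t)
  | gp_congD s s' t t' :
      gp_eq s s' -> gp_eq t t' -> gp_eq (TAdd s t) (TAdd s' t')
  | gp_congM s s' t t' :
      gp_eq s s' -> gp_eq t t' -> gp_eq (TMul s t) (TMul s' t')
  | gp_congB s s' t t' :
      gp_eq s s' -> gp_eq t t' -> gp_eq (TBr s t) (TBr s' t')
  | gp_addA s t u : gp_eq (TAdd s (TAdd t u)) (TAdd (TAdd s t) u)
  | gp_addC s t : gp_eq (TAdd s t) (TAdd t s)
  | gp_add0 t : gp_eq (TAdd TZero t) t
  | gp_addN t : gp_eq (TAdd (TOpp t) t) TZero
  | gp_scaleA a b t : gp_eq (TScale a (TScale b t)) (TScale (a * b) t)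
  | gp_scale1 t : gp_eq (TScale 1 t) t
  | gp_scaleDr a s t :
      gp_eq (TScale a (TAdd s t)) (TAdd (TScale a s) (TScale a t))
  | gp_scaleDl a b t :
      gp_eq (TScale (a + b) t) (TAdd (TScale a t) (TScale b t))
  | gp_mulA s t u : gp_eq (TMul s (TMul t u)) (TMul (TMul s t) u)
  | gp_mulC s t : gp_eq (TMul s t) (TMul t s)
  | gp_mul1 t : gp_eq (TMul TOne t) t
  | gp_mulDl s t u : gp_eq (TMul (TAdd s t) u) (TAdd (TMul s u) (TMul t u))
  | gp_mulZl a s t : gp_eq (TMul (TScale a s) t) (TScale a (TMul s t))
  | gp_brC s t : gp_eq (TBr s t) (TOpp (TBr t s))
  | gp_brDl s t u : gp_eq (TBr (TAdd s t) u) (TAdd (TBr s u) (TBr t u))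
  | gp_brZl a s t : gp_eq (TBr (TScale a s) t) (TScale a (TBr s t))
  | gp_brDr s t u : gp_eq (TBr s (TAdd t u)) (TAdd (TBr s t) (TBr s u))
  | gp_brZr a s t : gp_eq (TBr s (TScale a t)) (TScale a (TBr s t))
  | gp_brMr s t u :
      gp_eq (TBr s (TMul t u)) (TAdd (TMul (TBr s t) u) (TMul (TBr s u) t)).

Definition gp_eqb (s t : T) : bool := `[< gp_eq s t >].

Lemma gp_eqb_refl : reflexive gp_eqb.
Proof. by move=> t; apply/asboolP; exact: gp_refl. Qed.

Lemma gp_eqb_sym : symmetric gp_eqb.
Proof. by move=> s t; apply: asbool_equiv_eq; split; exact: gp_sym. Qed.

Lemma gp_eqb_trans : transitive gp_eqb.
Proof.
move=> t s u /asboolP st /asboolP tu; apply/asboolP; exact: gp_trans tu.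
Qed.

Canonical gp_equiv := EquivRel gp_eqb gp_eqb_refl gp_eqb_sym gp_eqb_trans.

Definition GP : Type := {eq_quot gp_equiv}.

HB.instance Definition _ := Choice.on GP.
HB.instance Definition _ := Quotient.on GP.

Definition pi_GP (t : T) : GP := \pi_GP t.
Definition repr_GP (u : GP) : T := repr u.

Lemma pi_GPP s t : gp_eq s t <-> pi_GP s = pi_GP t.
Proof.
split; first by move=> st; apply/eqmodP/asboolP.
by move=> /eqmodP /asboolP.
Qed.

Lemma repr_GPK : cancel repr_GP pi_GP.
Proof. exact: reprK. Qed.

Lemma repr_pi_GP t : gp_eq (repr_GP (pi_GP t)) t.
Proof. by apply/pi_GPP; rewrite repr_GPK. Qed.

Definition GP_opp u := pi_GP (TOpp (repr_GP u)).
Definition GP_scale a u := pi_GP (TScale a (repr_GP u)).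
Definition GP_add u v := pi_GP (TAdd (repr_GP u) (repr_GP v)).
Definition GP_mul u v := pi_GP (TMul (repr_GP u) (repr_GP v)).
Definition GP_br u v := pi_GP (TBr (repr_GP u) (repr_GP v)).

Lemma GP_oppE t : GP_opp (pi_GP t) = pi_GP (TOpp t).
Proof. by apply/pi_GPP/gp_congN/repr_pi_GP. Qed.
Lemma GP_scaleE a t : GP_scale a (pi_GP t) = pi_GP (TScale a t).
Proof. by apply/pi_GPP/gp_congZ/repr_pi_GP. Qed.
Lemma GP_addE s t : GP_add (pi_GP s) (pi_GP t) = pi_GP (TAdd s t).
Proof. by apply/pi_GPP/gp_congD; apply: repr_pi_GP. Qed.
Lemma GP_mulE s t : GP_mul (pi_GP s) (pi_GP t) = pi_GP (TMul s t).
Proof. by apply/pi_GPP/gp_congM; apply: repr_pi_GP. Qed.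
Lemma GP_brE s t : GP_br (pi_GP s) (pi_GP t) = pi_GP (TBr s t).
Proof. by apply/pi_GPP/gp_congB; apply: repr_pi_GP. Qed.

Let piE := (GP_oppE, GP_scaleE, GP_addE, GP_mulE, GP_brE).

Lemma GP_ind (P : GP -> Prop) : (forall t, P (pi_GP t)) -> forall u, P u.
Proof. by move=> Pt u; rewrite -(repr_GPK u). Qed.

Ltac by_gp ax := do ![elim/GP_ind => ?]; rewrite !piE; apply/pi_GPP; exact: ax.

Fact GP_addA : associative GP_add. Proof. by_gp gp_addA. Qed.
Fact GP_addC : commutative GP_add. Proof. by_gp gp_addC. Qed.
Fact GP_add0 : left_id (pi_GP TZero) GP_add. Proof. by_gp gp_add0. Qed.
Fact GP_addN : left_inverse (pi_GP TZero) GP_opp GP_add.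
Proof. by_gp gp_addN. Qed.

HB.instance Definition _ :=
  GRing.isZmodule.Build GP GP_addA GP_addC GP_add0 GP_addN.

(* Evaluation of a term at 1 in [K] with the zero bracket, which separates 1
   from 0. *)
Fixpoint ev1 (t : T) : K :=
  match t with
  | TVar _ => 1
  | TZero => 0
  | TOne => 1
  | TOpp s => - ev1 s
  | TScale a s => a * ev1 s
  | TAdd s u => ev1 s + ev1 u
  | TMul s u => ev1 s * ev1 u
  | TBr _ _ => 0
  end.

Lemma ev1P s t : gp_eq s t -> ev1 s = ev1 t.
Proof. by elim=> {s t} //=; intros; try congruence; ring. Qed.

Fact GP_scaleA a b v : GP_scale a (GP_scale b v) = GP_scale (a * b) v.
Proof. by move: v; by_gp gp_scaleA. Qed.
Fact GP_scale1 : left_id 1 GP_scale. Proof. by_gp gp_scale1. Qed.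
Fact GP_scaleDr : right_distributive GP_scale GP_add.
Proof. by move=> a; by_gp gp_scaleDr. Qed.
Fact GP_scaleDl v a b :
  GP_scale (a + b) v = GP_add (GP_scale a v) (GP_scale b v).
Proof. by move: v; by_gp gp_scaleDl. Qed.

HB.instance Definition _ := GRing.Zmodule_isLmodule.Build K GP
  GP_scaleA GP_scale1 GP_scaleDr GP_scaleDl.

Fact GP_mulA : associative GP_mul. Proof. by_gp gp_mulA. Qed.
Fact GP_mulC : commutative GP_mul. Proof. by_gp gp_mulC. Qed.
Fact GP_mul1 : left_id (pi_GP TOne) GP_mul. Proof. by_gp gp_mul1. Qed.
Fact GP_mulDl : left_distributive GP_mul GP_add. Proof. by_gp gp_mulDl. Qed.
Fact GP_oner_neq0 : pi_GP TOne != 0.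
Proof. by apply/eqP => /pi_GPP /ev1P /eqP; rewrite /= oner_eq0. Qed.

HB.instance Definition _ := GRing.Zmodule_isComNzRing.Build GP
  GP_mulA GP_mulC GP_mul1 GP_mulDl GP_oner_neq0.

Fact GP_scaleAl a u v : GP_scale a (GP_mul u v) = GP_mul (GP_scale a u) v.
Proof. by apply/esym; move: u v; by_gp gp_mulZl. Qed.

HB.instance Definition _ := GRing.Lmodule_isLalgebra.Build K GP GP_scaleAl.
HB.instance Definition _ := GRing.Lalgebra_isComAlgebra.Build K GP.

Fact GP_br_linearl v : linear (GP_br^~ v).
Proof.
move=> a u w; elim/GP_ind: u => u; elim/GP_ind: w => w; elim/GP_ind: v => v.
rewrite /GRing.scale /GRing.add /= !piE; apply/pi_GPP.
by apply: gp_trans (gp_brDl _ _ _) _; apply: gp_congD;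
  [exact: gp_brZl | exact: gp_refl].
Qed.

Fact GP_br_linearr u : linear (GP_br u).
Proof.
move=> a v w; elim/GP_ind: u => u; elim/GP_ind: w => w; elim/GP_ind: v => v.
rewrite /GRing.scale /GRing.add /= !piE; apply/pi_GPP.
by apply: gp_trans (gp_brDr _ _ _) _; apply: gp_congD;
  [exact: gp_brZr | exact: gp_refl].
Qed.

Fact GP_brC u v : GP_br u v = GP_opp (GP_br v u).
Proof. by move: u v; by_gp gp_brC. Qed.
Fact GP_brMr u v w : GP_br u (GP_mul v w) =
  GP_add (GP_mul (GP_br u v) w) (GP_mul (GP_br u w) v).
Proof. by move: u v w; by_gp gp_brMr. Qed.

HB.instance Definition _ := isGenericPoisson.Build K GP
  GP_br_linearl GP_br_linearr GP_brC GP_brMr.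

Definition GP_gen (x : X) : GP := pi_GP (TVar x).

Lemma pi_GP0 : pi_GP TZero = 0. Proof. by []. Qed.
Lemma pi_GP1 : pi_GP TOne = 1. Proof. by []. Qed.
Lemma pi_GPN t : pi_GP (TOpp t) = - pi_GP t.
Proof. exact/esym/GP_oppE. Qed.
Lemma pi_GPZ a t : pi_GP (TScale a t) = a *: pi_GP t.
Proof. exact/esym/GP_scaleE. Qed.
Lemma pi_GPD s t : pi_GP (TAdd s t) = pi_GP s + pi_GP t.
Proof. exact/esym/GP_addE. Qed.
Lemma pi_GPM s t : pi_GP (TMul s t) = pi_GP s * pi_GP t.
Proof. exact/esym/GP_mulE. Qed.
Lemma pi_GPB s t : pi_GP (TBr s t) = bracket (pi_GP s) (pi_GP t).
Proof. exact/esym/GP_brE. Qed.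

Definition pi_GPE := (pi_GP0, pi_GP1, pi_GPN, pi_GPZ, pi_GPD, pi_GPM, pi_GPB).

End Free.

Arguments GP_gen K {X} x.

Section UniversalProperty.
Variables (K : fieldType) (X : Type) (A : gpAlgType K) (v : X -> A).

Fixpoint term_eval (t : term K X) : A :=
  match t with
  | TVar x => v x
  | TZero => 0
  | TOne => 1
  | TOpp s => - term_eval s
  | TScale a s => a *: term_eval s
  | TAdd s u => term_eval s + term_eval u
  | TMul s u => term_eval s * term_eval u
  | TBr s u => bracket (term_eval s) (term_eval u)
  end.

Lemma term_evalP s t : gp_eq s t -> term_eval s = term_eval t.
Proof.
elim=> {s t} //=; intros; try congruence.
- exact: addrA.
- exact: addrC.
- exact: add0r.
- exact: addNr.
- exact: scalerA.
- exact: scale1r.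
- exact: scalerDr.
- exact: scalerDl.
- exact: mulrA.
- exact: mulrC.
- exact: mul1r.
- exact: mulrDl.
- by rewrite scalerAl.
- exact: bracketC.
- by have := bracket_linearl (term_eval u) 1 (term_eval s) (term_eval t);
    rewrite !scale1r.
- by have := bracket_linearl (term_eval t) a (term_eval s) 0;
    rewrite !addr0 => ->;
    have := bracket_linearl (term_eval t) (-1) 0 0;
    rewrite scaler0 addr0 scaleN1r addNr => ->; rewrite addr0.
- by have := bracket_linearr (term_eval s) 1 (term_eval t) (term_eval u);
    rewrite !scale1r.
- by have := bracket_linearr (term_eval s) a (term_eval t) 0;
    rewrite !addr0 => ->;
    have := bracket_linearr (term_eval s) (-1) 0 0;
    rewrite scaler0 addr0 scaleN1r addNr => ->; rewrite addr0.
- exact: bracketMr.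
Qed.

Definition GP_lift (u : GP K X) : A := term_eval (repr_GP u).

Lemma GP_liftE t : GP_lift (pi_GP t) = term_eval t.
Proof. exact/term_evalP/repr_pi_GP. Qed.

Fact GP_lift_linear : linear GP_lift.
Proof.
move=> a u w; elim/GP_ind: u => u; elim/GP_ind: w => w.
by rewrite -pi_GPZ -pi_GPD !GP_liftE.
Qed.

Fact GP_lift_monoid : monoid_morphism GP_lift.
Proof.
split; first by rewrite -pi_GP1 GP_liftE.
move=> u w; elim/GP_ind: u => u; elim/GP_ind: w => w.
by rewrite -pi_GPM !GP_liftE.
Qed.

HB.instance Definition _ := GRing.isLinear.Build K (GP K X) A _ GP_lift
  GP_lift_linear.
HB.instance Definition _ := GRing.isMonoidMorphism.Build (GP K X) A GP_lift
  GP_lift_monoid.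

Lemma GP_lift_bracket u w :
  GP_lift (bracket u w) = bracket (GP_lift u) (GP_lift w).
Proof.
elim/GP_ind: u => u; elim/GP_ind: w => w.
by rewrite -pi_GPB !GP_liftE.
Qed.

Lemma GP_lift_gen x : GP_lift (GP_gen K x) = v x.
Proof. exact: GP_liftE. Qed.

Lemma GP_lift_unique (g : {lrmorphism GP K X -> A}) :
  (forall u w, g (bracket u w) = bracket (g u) (g w)) ->
  (forall x, g (GP_gen K x) = v x) -> g =1 GP_lift.
Proof.
move=> gB gv u; elim/GP_ind: u; elim=> [x|||t IH|a t IH|s IHs t IHt|s IHs t IHt
  |s IHs t IHt]; rewrite ?gv ?GP_lift_gen // !pi_GPE.
- by rewrite !raddf0.
- by rewrite !rmorph1.
- by rewrite !raddfN /= IH.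
- by rewrite !linearZ /= IH.
- by rewrite !raddfD /= IHs IHt.
- by rewrite !rmorphM /= IHs IHt.
- by rewrite gB GP_lift_bracket IHs IHt.
Qed.

End UniversalProperty.

(* For injective [h], the image of [GP_map K h] is the copy of [GP K X] inside
   [GP K Y]. *)
Definition GP_map (K : fieldType) (X Y : Type) (h : X -> Y) :
  GP K X -> GP K Y := GP_lift (fun x => GP_gen K (h x)).

Arguments GP_map K {X Y} h.

Lemma GP_map_inj (K : fieldType) (X Y : Type) (h : X -> Y) :
  injective h -> injective (GP_map K h).
Proof.
move=> h_inj.
pose r y : GP K X := if pselect (exists x, h x = y) is left p
                     then GP_gen K (projT1 (cid p)) else 0.
suff K_r : cancel (GP_map K h) (GP_lift r) by exact: can_inj K_r.
elim/GP_ind; elim=> [x|||t IH|a t IH|s IHs t IHt|s IHs t IHt|s IHs t IHt].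
- rewrite [GP_map _ _ _]GP_lift_gen GP_lift_gen /r.
  case: pselect => [p|[]]; last by exists x.
  by case: cid => x' /= /h_inj ->.
- by rewrite !pi_GPE /GP_map !raddf0.
- by rewrite !pi_GPE /GP_map !rmorph1.
- by rewrite !pi_GPE /GP_map !raddfN /= [GP_lift r _]IH.
- by rewrite !pi_GPE /GP_map !linearZ /= [GP_lift r _]IH.
- by rewrite !pi_GPE /GP_map !raddfD /= [GP_lift r _]IHs [X in _ + X]IHt.
- by rewrite !pi_GPE /GP_map !rmorphM /= [GP_lift r _]IHs [X in _ * X]IHt.
- rewrite !pi_GPE /GP_map !GP_lift_bracket.
  by rewrite [GP_lift r _]IHs [X in bracket _ X]IHt.
Qed.

(* Main.v *)
From HB Require Import structures.
Require Import Defs.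
From mathcomp Require Import all_boot all_algebra ring.
From mathcomp Require Import separable mpoly.
From mathcomp Require Import boolp classical_sets.

(** The ideal generated by [f] meets [GP X] trivially as soon as some morphism
    of GP-algebras out of [GP (X + x)] kills [f] and is injective on [GP X].
    Such a morphism exists because, without the Jacobi identity, a bracket may
    take arbitrary values on algebraically independent elements: the equation
    [f = 0] can be solved for a single bracket word.

    Modulo anticommutativity and the Leibniz rule every element of [GP Y] is a
    commutative polynomial in normal bracket words ([word_poly_lift]). Write [f]
    as a polynomial [F] in finitely many normal words. As [f] is not in [GP X],
    some word that involves [x] really occurs in [F]; let [w] be one of maximal
    size. Take independent variables [t_k], one for each of the finitely many
    words [s_k] under consideration, let [E] be the field of fractions of their
    polynomial ring, and adjoin to [E] a root [z] of [F], seen as a polynomial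
    in the variable of [w] alone ([generic_root]). In characteristic zero the
    root can be adjoined by a separable polynomial [p], so the partial
    derivatives [d_i] along the [t_i] extend to [L = E[z]/(p)]. For any
    antisymmetric family [c] of elements of [L],

      {a, b} = sum over i, k of c_ik (d_i a) (d_k b)

    is a biderivation with {t_i, t_k} = c_ik ([bv_alg]). Choose [c] so that
    bracketing follows the formation of words, except that the bracket which
    should produce [w] gives [z]; if [w] is the letter [x], send [x] to [z]. The induced morphism then sends [w] to [z] and
    every word that does not contain [w] to its own variable ([solve_word]). By
    maximality of [w] it sends [f] to [F] evaluated at [w := z], that is to
    zero. Words over [X] never contain [w], so an element of [GP X] goes to the
    same polynomial in independent variables, which vanishes only if the
    element does. *)

Import GRing.Theory.
Local Open Scope ring_scope.
Local Open Scope classical_set_scope.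

Set Implicit Arguments.
Unset Strict Implicit.
Unset Printing Implicit Defensive.

(** * Derivations of commutative rings and their extensions *)

Record is_derivation (R : comNzRingType) (d : R -> R) : Prop := IsDerivation {
  derD : {morph d : x y / x + y};
  derM : forall x y, d (x * y) = d x * y + x * d y
}.

Section DerivationTheory.
Variables (R : comNzRingType) (d : R -> R).
Hypothesis der_d : is_derivation d.

Lemma der0 : d 0 = 0.
Proof. by apply: (@addrI _ (d 0)); rewrite -(derD der_d) !addr0. Qed.

Lemma der1 : d 1 = 0.
Proof.
by apply: (@addrI _ (d 1)); rewrite addr0 -{3}[1]mulr1 (derM der_d) mul1r mulr1.
Qed.

Lemma der_sum (I : Type) (r : seq I) (P : pred I) (F : I -> R) :
  d (\sum_(i <- r | P i) F i) = \sum_(i <- r | P i) d (F i).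
Proof. exact: (big_morph d (derD der_d) der0). Qed.

End DerivationTheory.

Section FractionDerivation.
(* [E] is a field of fractions of [R] known only through its embedding, so that
   computations in [E] stay symbolic. *)
Variables (R : idomainType) (E : fieldType) (F : {rmorphism R -> E}) (d : R -> R).
Hypothesis F_inj : injective F.
Hypothesis F_frac : forall x, exists ab : R * R, ab.2 != 0 /\ x = F ab.1 / F ab.2.
Hypothesis der_d : is_derivation d.

Lemma frac_embed_neq0 b : b != 0 -> F b != 0.
Proof. by move=> b0; rewrite -(rmorph0 F) (inj_eq F_inj). Qed.

(** The quotient rule does not depend on the fraction that represents an element
    of [E]: differentiate [a * b' = a' * b]. *)
Lemma quotient_rule a b a' b' : b != 0 -> b' != 0 ->
    F a / F b = F a' / F b' ->
  (F (d a) * F b - F a * F (d b)) / F b ^+ 2 =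
  (F (d a') * F b' - F a' * F (d b')) / F b' ^+ 2.
Proof.
move=> /frac_embed_neq0 Fb0 /frac_embed_neq0 Fb'0 eq_ab.
have ab : a * b' = a' * b.
  apply: F_inj; rewrite !rmorphM; apply: (mulIf (invr_neq0 Fb0)).
  by rewrite mulrAC eq_ab mulfVK // mulfK.
have := congr1 (fun x => F (d x)) ab.
rewrite /= !(derM der_d) !rmorphD !rmorphM /=.
set q := F a / F b in eq_ab; have -> : F a = q * F b by rewrite /q mulfVK.
have -> : F a' = q * F b' by rewrite eq_ab mulfVK.
move=> /(canRL (addrK _)) dab.
have -> : F (d a) = (F (d a') * F b + q * F b' * F (d b) - q * F b * F (d b'))
    / F b' by rewrite -dab mulfK.
by field; rewrite Fb0 Fb'0.
Qed.

Lemma fraction_derivation : exists D : E -> E,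
  is_derivation D /\ forall a, D (F a) = F (d a).
Proof.
pose num x := (projT1 (cid (F_frac x))).1.
pose den x := (projT1 (cid (F_frac x))).2.
have den0 x : den x != 0 by rewrite /den; case: cid => ? [].
have numdenE x : x = F (num x) / F (den x).
  by rewrite /num /den; case: cid => ? [].
pose D x :=
  (F (d (num x)) * F (den x) - F (num x) * F (d (den x))) / F (den x) ^+ 2.
have DE a b : b != 0 ->
    D (F a / F b) = (F (d a) * F b - F a * F (d b)) / F b ^+ 2.
  by move=> b0; apply: quotient_rule.
exists D; split; last first.
  move=> a; rewrite -[F a]divr1 -(rmorph1 F) DE ?oner_eq0 // (der1 der_d).
  by rewrite rmorph0 rmorph1 mulr1 mulr0 subr0 expr1n divr1.
split=> x y; rewrite (numdenE x) (numdenE y);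
  have Fx := frac_embed_neq0 (den0 x); have Fy := frac_embed_neq0 (den0 y).
- have -> : F (num x) / F (den x) + F (num y) / F (den y) =
      F (num x * den y + num y * den x) / F (den x * den y).
    by rewrite rmorphD !rmorphM /=; field; rewrite Fx Fy.
  rewrite !DE ?mulf_neq0 // !(derD der_d) !(derM der_d) !rmorphD !rmorphM /=.
  by field; rewrite Fx Fy.
- have -> : F (num x) / F (den x) * (F (num y) / F (den y)) =
      F (num x * num y) / F (den x * den y).
    by rewrite !rmorphM /=; field; rewrite Fx Fy.
  rewrite !DE ?mulf_neq0 // !(derM der_d) !rmorphD !rmorphM /=.
  by field; rewrite Fx Fy.
Qed.

End FractionDerivation.

Lemma tofrac_surj (R : idomainType) (x : {fraction R}) :
  exists ab : R * R, ab.2 != 0 /\ x = tofrac ab.1 / tofrac ab.2.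
Proof.
elim/quotW: x => -[[a b] /= b0]; exists (a, b); split => //=.
have Fb0 : tofrac b != 0 by rewrite tofrac_eq0.
apply: (mulIf Fb0); rewrite mulfVK //; rewrite /GRing.mul /= !piE.
apply/eqmodP; rewrite /= FracField.equivfE /FracField.mulf /=.
by rewrite !numden_Ratio ?oner_eq0 ?mulr1 // mulrC.
Qed.

Lemma tofrac_inj (R : idomainType) : injective (@tofrac R).
Proof. by move=> a b /eqP; rewrite tofrac_eq => /eqP. Qed.

Section QpolyDerivation.
Variables (E : fieldType) (p : {poly E}) (d : E -> E).
Hypotheses (p_monic : p \is monic) (p_gt1 : (1 < size p)%N).
Hypotheses (p_sep : separable_poly p) (der_d : is_derivation d).

Lemma mk_monic_id : mk_monic p = p.
Proof. by rewrite /mk_monic p_gt1 p_monic. Qed.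

Lemma in_qpoly_modulus : in_qpoly p p = 0.
Proof. by apply: val_inj; rewrite /= mk_monic_id Pdiv.RingMonic.rmodpp. Qed.

Lemma qpoly_decomp (q : {poly E}) :
  exists k : {poly E}, q = k * p + (in_qpoly p q : {poly E}).
Proof.
exists (Pdiv.Ring.rdivp q p); rewrite /= mk_monic_id.
exact: Pdiv.RingMonic.rdivp_eq.
Qed.

Lemma coef_map_der q i : (map_poly d q)`_i = d q`_i.
Proof. exact: coef_map_id0 (der0 der_d). Qed.

Lemma map_poly_der : is_derivation (map_poly d).
Proof.
split=> q r; apply/polyP => i.
  by rewrite coefD !coef_map_der coefD (derD der_d).
rewrite coefD !coefM coef_map_der coefM (der_sum der_d) -big_split /=.
by apply: eq_bigr => j _; rewrite !coef_map_der (derM der_d).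
Qed.

(** On [E[X]] the derivation [d] acts on coefficients and may send [X] to any
    polynomial. The image of [X] is chosen so that the ideal of [p] is preserved:
    differentiating [p(X) = 0] forces it to be [- (d p)(X) / p'(X)], which makes
    sense modulo [p] since [p] is separable. *)
Lemma qpoly_derivation : exists D : {poly %/ p} -> {poly %/ p},
  is_derivation D /\
  forall e, D (in_qpoly p e%:P) = in_qpoly p (d e)%:P.
Proof.
have [[u v] /= uv1] : exists uv : {poly E} * {poly E},
    uv.1 * p + uv.2 * p^`() = 1.
  by apply/Bezout_eq1_coprimepP; move: p_sep; rewrite separable_poly.unlock.
pose dm := map_poly d; have der_dm : is_derivation dm := map_poly_der.
(* The factor [v] is an inverse of [p^`()] modulo [p]. *)
pose delta q := dm q - v * dm p * q^`().
have der_delta : is_derivation delta.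
  split=> q r; rewrite /delta.
    by rewrite (derD der_dm) derivD; ring.
  by rewrite (derM der_dm) derivM; ring.
have delta_p : in_qpoly p (delta p) = 0.
  have -> : delta p = u * dm p * p.
    by rewrite /delta -[X in X - _]mul1r -uv1; ring.
  by rewrite rmorphM /= in_qpoly_modulus mulr0.
pose D (x : {poly %/ p}) : {poly %/ p} := in_qpoly p (delta x).
have DE q : D (in_qpoly p q) = in_qpoly p (delta q).
  have [k def_q] := qpoly_decomp q.
  rewrite /D [in RHS]def_q; move: (_ q) => r /=.
  rewrite (derD der_delta) (derM der_delta) !in_qpolyD !in_qpolyM.
  by rewrite in_qpoly_modulus delta_p !mulr0 !add0r.
have in_surj (x : {poly %/ p}) : x = in_qpoly p (x : {poly E}).
  by apply: val_inj; rewrite [RHS]in_qpoly_small // size_mk_monic.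
exists D; split; last first.
  move=> e; rewrite DE /delta derivC mulr0 subr0 /dm; congr in_qpoly.
  apply/polyP=> i; rewrite coef_map_der !coefC; case: eqP => // _.
  exact: der0.
split=> x y; rewrite (in_surj x) (in_surj y).
  by rewrite -in_qpolyD !DE (derD der_delta) in_qpolyD.
by rewrite -in_qpolyM !DE (derM der_delta) in_qpolyD !in_qpolyM.
Qed.

End QpolyDerivation.

(** * Evaluation and partial derivatives of multivariate polynomials *)

Section MpolyTheory.
Variables (K : comNzRingType) (n : nat).

Lemma mpoly_ring_ind (P : {mpoly K[n]} -> Prop) :
    (forall c, P c%:MP) -> (forall i, P 'X_i) ->
    (forall p q, P p -> P q -> P (p + q)) ->
    (forall p q, P p -> P q -> P (p * q)) ->
  forall p, P p.
Proof.
move=> PC PX PD PM p; have P1 : P 1 by rewrite -mpolyC1.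
rewrite (mpolyE p); apply: (big_ind P) => // [|m _]; first by rewrite -mpolyC0.
rewrite -mul_mpolyC; apply: (PM) => //; rewrite mpolyXE_id.
apply: (big_ind P) => // i _; elim: (m i) => [|k IH]; first by rewrite expr0.
by rewrite exprS; apply: PM.
Qed.

Lemma rmorph_mmap (S S' : comNzRingType) (phi : {rmorphism S -> S'})
    (f : {rmorphism K -> S}) (f' : {rmorphism K -> S'}) (h : 'I_n -> S) p :
  (forall c, phi (f c) = f' c) -> phi (mmap f h p) = mmap f' (phi \o h) p.
Proof.
move=> ff'; elim/mpoly_ring_ind: p => [c|i|p q IHp IHq|p q IHp IHq].
- by rewrite !mmapC ff'.
- by rewrite !mmapX !mmap1U.
- by rewrite !rmorphD IHp IHq.
- by rewrite !rmorphM IHp IHq.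
Qed.

Lemma mmap_id (p : {mpoly K[n]}) : mmap (@mpolyC n K) (fun i => 'X_i) p = p.
Proof.
elim/mpoly_ring_ind: p => [c|i|p q IHp IHq|p q IHp IHq].
- by rewrite mmapC.
- by rewrite mmapX mmap1U.
- by rewrite rmorphD /= IHp IHq.
- by rewrite rmorphM /= IHp IHq.
Qed.

Lemma mderivU i k : ('X_k : {mpoly K[n]})^`M(i) = (i == k)%:R.
Proof.
rewrite mderivX mnm1E eq_sym; have [->|_] := eqVneq; last by rewrite scale0r.
suff -> : (U_(k) - U_(k) = 0 :> 'X_{1.. n})%MM by rewrite mpolyX0 scale1r.
by apply/mnmP => l; rewrite mnmBE subnn mnm0E.
Qed.

Lemma mmap_chain_rule (S : comNzRingType) (f : {rmorphism K -> S})
    (h : 'I_n -> S) (d : S -> S) p :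
    is_derivation d -> (forall c, d (f c) = 0) ->
  d (mmap f h p) = \sum_i mmap f h p^`M(i) * d (h i).
Proof.
move=> der_d df; elim/mpoly_ring_ind: p => [c|j|p q IHp IHq|p q IHp IHq].
- by rewrite mmapC df big1 // => i _; rewrite mderivC mmap0 mul0r.
- rewrite mmapX mmap1U (bigD1 j) //= big1 ?addr0 => [|i ij].
    by rewrite mderivU eqxx rmorph1 mul1r.
  by rewrite mderivU (negPf ij) rmorph0 mul0r.
- rewrite rmorphD /= (derD der_d) IHp IHq -big_split /=.
  by apply: eq_bigr => i _; rewrite mderivD mmapD mulrDl.
- rewrite rmorphM /= (derM der_d) IHp IHq mulr_suml mulr_sumr -big_split /=.
  by apply: eq_bigr => i _; rewrite mderivM mmapD !rmorphM /=; ring.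
Qed.

End MpolyTheory.

Section OccurringVariables.
Variables (K : fieldType) (n : nat).

Lemma mderiv_neq0 (p : {mpoly K[n]}) m i : [pchar K] =i pred0 ->
  m \in msupp p -> (0 < m i)%N -> p^`M(i) != 0.
Proof.
move=> charK0 mp mi_gt0; apply: contraTneq mp => /(congr1 (mcoeff (m - U_(i))%MM)).
have mK : (m - U_(i) + U_(i))%MM = m.
  by rewrite submK //; apply/mnm_lepP => j; rewrite mnm1E; case: eqP => // <-.
rewrite mcoeff_deriv mcoeff0 mK -mulr_natr => /eqP.
by rewrite mulf_eq0 (pcharf0P K).1 // orbF => /eqP pm0;
  rewrite mcoeff_msupp pm0 eqxx.
Qed.

(** In characteristic zero, the non-vanishing of the partial derivative is a
    test for the occurrence of a variable. *)
Lemma eq_mmap_mderiv (S : comNzRingType) (f : K -> S) (h h' : 'I_n -> S)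
    (p : {mpoly K[n]}) : [pchar K] =i pred0 ->
  (forall i, p^`M(i) != 0 -> h i = h' i) -> mmap f h p = mmap f h' p.
Proof.
move=> charK0 hh'; apply: eq_big_seq => m mp; congr (_ * _).
apply: eq_bigr => i _; have [->|mi_gt0] := posnP (m i); first by rewrite !expr0.
by rewrite hh' // (mderiv_neq0 _ mp).
Qed.

End OccurringVariables.

(** * Adjoining a root in one variable *)

Lemma separable_factor (E : fieldType) (q : {poly E}) : q^`() != 0 ->
  exists p : {poly E},
    [/\ p \is monic, (1 < size p)%N, separable_poly p & p %| q].
Proof.
move=> dq0; have q0 : q != 0 by apply: contraNneq dq0 => ->; rewrite deriv0.
pose g := gcdp q q^`(); pose p := q %/ g.
have pg : p * g = q by rewrite divpK ?dvdp_gcdl.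
have p0 : p != 0 by apply: contraNneq q0 => p0; rewrite -pg p0 mul0r.
have g0 : g != 0 by apply: contraNneq q0 => g0; rewrite -pg g0 mulr0.
have size_g : (size g < size q)%N.
  by apply: leq_ltn_trans (lt_size_deriv q0); rewrite dvdp_leq ?dvdp_gcdr.
have lp0 : (lead_coef p)^-1 != 0 by rewrite invr_eq0 lead_coef_eq0.
have pp' : (lead_coef p)^-1 *: p %= p by rewrite eqp_scale.
exists ((lead_coef p)^-1 *: p); split.
- by rewrite monicE lead_coefZ mulVf ?lead_coef_eq0.
- rewrite size_scale // ltnNge; apply: contraL size_g => p_le1.
  have /eqP p1 : size p == 1%N by rewrite eqn_leq p_le1 size_poly_gt0.
  by rewrite -leqNgt -pg size_mul // p1.
- by rewrite (eqp_separable pp'); apply: make_separable.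
- by rewrite (eqp_dvdl _ pp') -pg dvdp_mulr.
Qed.

Section GenericRoot.
Variables (K : fieldType) (n : nat) (F : {mpoly K[n]}) (j : 'I_n).
Variables (E : fieldType) (phi : {rmorphism {mpoly K[n]} -> E}).
Hypothesis phi_inj : injective phi.
Hypothesis phi_frac : forall x, exists ab : {mpoly K[n]} * {mpoly K[n]},
  ab.2 != 0 /\ x = phi ab.1 / phi ab.2.

(** The elements [t i], including [t j], stay independent variables of [L], and
    [F] vanishes once [t j] is replaced by [z]. Here [L] is the quotient of
    [E[X]] by a separable factor [p] of [F], into which constants embed because
    [p] is not constant; since [p] may be reducible, [L] is only a ring. *)
Lemma generic_root : F^`M(j) != 0 ->
  exists (L : comNzRingType) (iota : {rmorphism K -> L}) (t : 'I_n -> L) (z : L)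
    (d : 'I_n -> L -> L),
  [/\ forall i, is_derivation (d i), forall i a, d i (iota a) = 0,
      forall i k, d i (t k) = (i == k)%:R,
      forall G, mmap iota t G = 0 -> G = 0 &
      mmap iota (fun i => if i == j then z else t i) F = 0].
Proof.
move=> dF0; pose R : idomainType := {mpoly K[n]}.
pose c : {rmorphism K -> {poly E}} := polyC \o phi \o @mpolyC n K.
pose X i : {poly E} := (phi 'X_i)%:P.
pose q : {poly E} := mmap c (fun i => if i == j then 'X else X i) F.
(* By the chain rule, [q^`()] at the [j]th variable is the image of [F^`M(j)]. *)
have dq : q^`() != 0.
  have der_deriv : is_derivation (fun r : {poly E} => r^`()).
    by split=> r s; [rewrite derivD | rewrite derivM; ring].
  have -> : q^`() = mmap c (fun i => if i == j then 'X else X i) F^`M(j).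
    rewrite /q (mmap_chain_rule _ F der_deriv) => [|a]; last exact: derivC.
    rewrite (bigD1 j) //= eqxx derivX mulr1 big1 ?addr0 // => i /negPf->.
    by rewrite derivC mulr0.
  apply: contraNneq dF0 => /(congr1 (horner_eval (phi 'X_j))).
  rewrite rmorph0.
  rewrite (@rmorph_mmap _ _ _ _ _ _ (phi \o @mpolyC n K)) => [|a]; last first.
    exact: hornerC.
  rewrite (_ : mmap _ _ _ = phi F^`M(j)).
    by rewrite -(rmorph0 phi) => /phi_inj/eqP.
  rewrite -[in RHS](mmap_id F^`M(j)).
  rewrite (@rmorph_mmap _ _ _ _ _ _ (phi \o @mpolyC n K)) //.
  apply: eq_bigr => m _; congr (_ * _); apply: mmap1_eq => i /=.
  by rewrite /horner_eval; case: eqP => [->|_]; rewrite (hornerX, hornerC).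
have [p [p_monic p_gt1 p_sep /dvdpP[r def_q]]] := separable_factor dq.
pose in_p : {rmorphism {poly E} -> {poly %/ p}} := in_qpoly p.
have dP i : exists D : {poly %/ p} -> {poly %/ p}, is_derivation D /\
    forall a : R, D (in_p (phi a)%:P) = in_p (phi a^`M(i))%:P.
  have der_i : is_derivation (fun a : R => a^`M(i)).
    by split; [exact: mderivD | exact: mderivM].
  have [D [der_D DE]] := fraction_derivation phi_inj phi_frac der_i.
  have [D' [der_D' D'E]] := qpoly_derivation p_monic p_gt1 p_sep der_D.
  by exists D'; split=> // a; rewrite D'E DE.
have in_pC_inj (a : R) : in_p (phi a)%:P = 0 -> a = 0.
  move=> a0; have : (in_qpoly p (phi a)%:P : {poly E}) = 0.
    by rewrite [in_qpoly _ _]a0.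
  rewrite in_qpoly_small.
    by move/eqP; rewrite polyC_eq0 -(rmorph0 phi) => /eqP/phi_inj.
  by rewrite mk_monic_id // (leq_ltn_trans (size_polyC_leq1 _)).
exists {poly %/ p}, (in_p \o c), (in_p \o X), (in_p 'X).
exists (fun i => projT1 (cid (dP i))); split.
- by move=> i; case: cid => D [].
- by move=> i a; case: cid => D [? DE] /=; rewrite DE mderivC !rmorph0.
- move=> i k; case: cid => D [? DE] /=; rewrite DE mderivU.
  by rewrite !rmorph_nat.
- move=> G tG0; apply: in_pC_inj; rewrite -tG0 -[in LHS](mmap_id G).
  exact: (@rmorph_mmap _ _ _ _ (in_p \o polyC \o phi)).
- rewrite (_ : mmap _ _ _ = in_p q).
    by rewrite def_q rmorphM /= in_qpoly_modulus // mulr0.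
  rewrite /q (@rmorph_mmap _ _ _ _ in_p _ (in_p \o c)) //.
  by apply: eq_bigr => m _; congr (_ * _); apply: mmap1_eq => i /=; case: eqP.
Qed.

End GenericRoot.

(** * GP-algebras from commutative rings with derivations *)

Record bivector (K : fieldType) (n : nat) := Bivector {
  bv_ring : comNzRingType;
  bv_inj : {rmorphism K -> bv_ring};
  bv_der : 'I_n -> bv_ring -> bv_ring;
  bv_coef : 'I_n -> 'I_n -> bv_ring;
  bv_derP : forall i, is_derivation (bv_der i);
  bv_der_inj : forall i a, bv_der i (bv_inj a) = 0;
  bv_coefC : forall i k, bv_coef i k = - bv_coef k i
}.

(** Any antisymmetric family of coefficients defines a bracket: only the Jacobi
    identity would constrain them further. *)
Section BivectorAlgebra.
Variables (K : fieldType) (n : nat) (B : bivector K n).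

Definition bv_alg : Type := bv_ring B.
HB.instance Definition _ := GRing.ComNzRing.on bv_alg.

Definition bv_scale (a : K) (x : bv_alg) : bv_alg := bv_inj B a * x.

Fact bv_scaleA a b x : bv_scale a (bv_scale b x) = bv_scale (a * b) x.
Proof. by rewrite /bv_scale rmorphM mulrA. Qed.
Fact bv_scale1 : left_id 1 bv_scale.
Proof. by move=> x; rewrite /bv_scale rmorph1 mul1r. Qed.
Fact bv_scaleDr : right_distributive bv_scale +%R.
Proof. by move=> a x y; rewrite /bv_scale mulrDr. Qed.
Fact bv_scaleDl x : {morph bv_scale^~ x : a b / a + b}.
Proof. by move=> a b; rewrite /bv_scale rmorphD mulrDl. Qed.

HB.instance Definition _ := GRing.Zmodule_isLmodule.Build K bv_alg
  bv_scaleA bv_scale1 bv_scaleDr bv_scaleDl.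

Fact bv_scaleAl a (x y : bv_alg) : a *: (x * y) = (a *: x) * y.
Proof. exact: mulrA. Qed.

HB.instance Definition _ := GRing.Lmodule_isLalgebra.Build K bv_alg bv_scaleAl.
HB.instance Definition _ := GRing.Lalgebra_isComAlgebra.Build K bv_alg.

Lemma bv_in_alg a : a%:A = bv_inj B a :> bv_alg.
Proof. exact: mulr1. Qed.

Definition bv_bracket (x y : bv_alg) : bv_alg :=
  \sum_p \sum_q bv_coef B p q * bv_der p x * bv_der q y.

Fact bv_bracketC x y : bv_bracket x y = - bv_bracket y x.
Proof.
rewrite /bv_bracket exchange_big -sumrN; apply: eq_bigr => p _.
rewrite -sumrN; apply: eq_bigr => q _; rewrite bv_coefC.
by rewrite !mulNr mulrAC.
Qed.

Fact bv_bracket_linearr x : linear (bv_bracket x).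
Proof.
move=> a y w; rewrite /bv_bracket scaler_sumr -big_split; apply: eq_bigr => p _ /=.
rewrite scaler_sumr -big_split; apply: eq_bigr => q _ /=.
rewrite /GRing.scale /= /bv_scale (derD (bv_derP B q)) (derM (bv_derP B q)).
by rewrite bv_der_inj; ring.
Qed.

Fact bv_bracket_linearl y : linear (bv_bracket^~ y).
Proof.
move=> a x w /=; rewrite (bv_bracketC _ y) bv_bracket_linearr.
by rewrite (bv_bracketC x) (bv_bracketC w) scalerN opprD.
Qed.

Fact bv_bracketMr x y w :
  bv_bracket x (y * w) = bv_bracket x y * w + bv_bracket x w * y.
Proof.
rewrite /bv_bracket !mulr_suml -big_split; apply: eq_bigr => p _ /=.
rewrite !mulr_suml -big_split; apply: eq_bigr => q _ /=.
by rewrite (derM (bv_derP B q)); ring.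
Qed.

HB.instance Definition _ := isGenericPoisson.Build K bv_alg
  bv_bracket_linearl bv_bracket_linearr bv_bracketC bv_bracketMr.

Lemma bv_bracket_coordinates (t : 'I_n -> bv_alg) a b :
    (forall i k, bv_der i (t k) = (i == k)%:R) ->
  bracket (t a) (t b) = bv_coef B a b.
Proof.
move=> dt; rewrite /bracket /= /bv_bracket (bigD1 a) //= [X in _ + X]big1 => [|p pa].
  rewrite addr0 (bigD1 b) //= big1 => [|q qb].
    by rewrite !dt !eqxx !mulr1 addr0.
  by rewrite !dt (negPf qb) mulr0.
by apply: big1 => q _; rewrite dt (negPf pa) mulr0 mul0r.
Qed.

End BivectorAlgebra.

(** * Bracket words *)

Section BracketTheory.
Variables (K : fieldType) (A : gpAlgType K).
Implicit Types x y w : A.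

Lemma bracketDr x y w : bracket x (y + w) = bracket x y + bracket x w.
Proof. by have := bracket_linearr x 1 y w; rewrite !scale1r. Qed.

Lemma bracketr0 x : bracket x 0 = 0.
Proof. by apply: (addrI (bracket x 0)); rewrite -bracketDr !addr0. Qed.

Lemma bracketZr x a y : bracket x (a *: y) = a *: bracket x y.
Proof. by have := bracket_linearr x a y 0; rewrite !addr0 bracketr0 addr0. Qed.

Lemma bracketr1 x : bracket x 1 = 0.
Proof.
by apply: (addrI (bracket x 1)); rewrite addr0 -{3}[1]mulr1 bracketMr !mulr1.
Qed.

Lemma bracketDl x y w : bracket (x + y) w = bracket x w + bracket y w.
Proof. by rewrite bracketC bracketDr opprD -!(bracketC _ w). Qed.

Lemma bracketMl x y w : bracket (x * y) w = bracket x w * y + bracket y w * x.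
Proof. by rewrite bracketC bracketMr opprD -!mulNr -!(bracketC _ w). Qed.

Lemma bracketxx x : [pchar K] =i pred0 -> bracket x x = 0.
Proof.
move=> charK0; have two0 : (2%:R : K) != 0 by rewrite (pcharf0P K).1.
apply: (scalerI two0); rewrite scaler0 scaler_nat mulr2n.
by rewrite {1}bracketC addNr.
Qed.

End BracketTheory.

Section Words.
Variable Y : countType.

Inductive word := Leaf of Y | Node of word & word.

(* The encoding into trees makes words countable; [pickle] then orders them. *)
Fixpoint word_tree w : GenTree.tree Y :=
  match w with
  | Leaf y => GenTree.Leaf y
  | Node a b => GenTree.Node 0 [:: word_tree a; word_tree b]
  end.

Fixpoint tree_word t : option word :=
  match t with
  | GenTree.Leaf y => Some (Leaf y)
  | GenTree.Node _ [:: a; b] =>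
    if tree_word a is Some a' then omap (Node a') (tree_word b) else None
  | _ => None
  end.

Lemma word_treeK : pcancel word_tree tree_word.
Proof. by elim=> //= a -> b ->. Qed.

HB.instance Definition _ := Countable.copy word (pcan_type word_treeK).

Fixpoint word_size w :=
  if w is Node a b then (word_size a + word_size b).+1 else 0%N.

Fixpoint subwords w :=
  w :: (if w is Node a b then subwords a ++ subwords b else [::]).

(** Normal words represent each class of words under swapping the two sides of a
    bracket by one word; the order by [pickle] is an arbitrary choice. *)
Fixpoint normal w :=
  if w is Node a b then [&& (pickle a < pickle b)%N, normal a & normal b]
  else true.

Fixpoint letters_in (Q : pred Y) w :=
  match w with Leaf y => Q y | Node a b => letters_in Q a && letters_in Q b end.

Lemma subwords_refl w : w \in subwords w.
Proof. by case: w => *; rewrite mem_head. Qed.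

Lemma subwords_size w w' :
  w' \in behead (subwords w) -> (word_size w' < word_size w)%N.
Proof.
elim: w w' => //= a IHa b IHb w'; rewrite mem_cat ltnS.
have sub_le c :
    (forall w, w \in behead (subwords c) -> (word_size w < word_size c)%N) ->
    w' \in subwords c -> (word_size w' <= word_size c)%N.
  move=> IHc; have -> : subwords c = c :: behead (subwords c) by case: (c).
  by rewrite inE => /predU1P[->//|/IHc/ltnW].
case/orP => [/(sub_le _ IHa)|/(sub_le _ IHb)] /leq_trans; apply.
  exact: leq_addr.
exact: leq_addl.
Qed.

Lemma subwords_over Q w w' : letters_in Q w -> w' \in subwords w -> letters_in Q w'.
Proof.
elim: w => [y|a IHa b IHb] /=; first by move=> Qy; rewrite mem_seq1 => /eqP->.
move=> /andP[Qa Qb].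
rewrite inE mem_cat => /predU1P[->|/orP[/IHa|/IHb]]; last 2 first.
- exact.
- exact.
by rewrite /= Qa.
Qed.

Lemma subwords_normal w w' : normal w -> w' \in subwords w -> normal w'.
Proof.
elim: w => [y|a IHa b IHb] /=; first by rewrite mem_seq1 => _ /eqP->.
move=> /and3P[ab Na Nb].
rewrite inE mem_cat => /predU1P[->|/orP[/IHa|/IHb]]; last 2 first.
- exact.
- exact.
by rewrite /= ab Na.
Qed.

Lemma subwords_node a b w :
  Node a b \in subwords w -> (a \in subwords w) && (b \in subwords w).
Proof.
elim: w => [y|c IHc d IHd] /=; first by rewrite mem_seq1.
rewrite !inE !mem_cat => /predU1P[[-> ->]|].
  by rewrite !subwords_refl !orbT.
by case/orP => [/IHc/andP[-> ->]|/IHd/andP[-> ->]]; rewrite !orbT.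
Qed.

Section Evaluation.
Variable K : fieldType.

Fixpoint word_eval w : GP K Y :=
  match w with
  | Leaf y => GP_gen K y
  | Node a b => bracket (word_eval a) (word_eval b)
  end.

(** The subalgebra, without bracket, generated by the values of the words in [P]. *)
Inductive word_poly (P : word -> Prop) : GP K Y -> Prop :=
  | WPConst a : word_poly P a%:A
  | WPWord w : P w -> word_poly P (word_eval w)
  | WPAdd u v : word_poly P u -> word_poly P v -> word_poly P (u + v)
  | WPMul u v : word_poly P u -> word_poly P v -> word_poly P (u * v).

Lemma word_poly_scale P a u : word_poly P u -> word_poly P (a *: u).
Proof. by rewrite -mulr_algl; apply: WPMul; exact: WPConst. Qed.

Lemma word_poly0 P : word_poly P 0.
Proof. by rewrite -(scale0r 1); exact: WPConst. Qed.

Lemma word_polyN P u : word_poly P u -> word_poly P (- u).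
Proof. by rewrite -scaleN1r; exact: word_poly_scale. Qed.

Lemma word_poly_mono (P Q : word -> Prop) u :
  (forall w, P w -> Q w) -> word_poly P u -> word_poly Q u.
Proof.
move=> PQ; elim=> [a|w /PQ|v v' _ Pv _ Pv'|v v' _ Pv _ Pv'];
  by [exact: WPConst | exact: WPWord | exact: WPAdd | exact: WPMul].
Qed.

Lemma word_poly_bracket P u v :
    (forall a b, P a -> P b ->
      word_poly P (bracket (word_eval a) (word_eval b))) ->
  word_poly P u -> word_poly P v -> word_poly P (bracket u v).
Proof.
move=> Pbr Pu; elim=> [a|b Pb|w w' Pw IHw Pw' IHw'|w w' Pw IHw Pw' IHw'].
- by rewrite bracketZr bracketr1 scaler0; exact: word_poly0.
- elim: Pu => [a|a Pa|w w' Pw IHw Pw' IHw'|w w' Pw IHw Pw' IHw'].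
  + by rewrite bracketC bracketZr bracketr1 scaler0 oppr0; exact: word_poly0.
  + exact: Pbr.
  + by rewrite bracketDl; exact: WPAdd.
  + by rewrite bracketMl; apply: WPAdd; apply: WPMul.
- by rewrite bracketDr; exact: WPAdd.
- by rewrite bracketMr; apply: WPAdd; apply: WPMul.
Qed.

(** Brackets of words are words up to sign, or vanish, so by the Leibniz rule
    polynomials in normal words are closed under the bracket. *)
Lemma word_poly_lift (Q : pred Y) (X : Type) (v : X -> GP K Y) (u : GP K X) :
    [pchar K] =i pred0 ->
    (forall x, word_poly (fun w => normal w && letters_in Q w) (v x)) ->
  word_poly (fun w => normal w && letters_in Q w) (GP_lift v u).
Proof.
move=> charK0 Pv; set P := (fun w => _).
have Pbr a b : P a -> P b -> word_poly P (bracket (word_eval a) (word_eval b)).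
  move=> /andP[Na Qa] /andP[Nb Qb].
  have [ab|ba|ab] := ltngtP (pickle a) (pickle b).
  - by apply: (@WPWord _ (Node a b)); rewrite /P /= ab Na Nb Qa.
  - rewrite bracketC; apply: word_polyN.
    by apply: (@WPWord _ (Node b a)); rewrite /P /= ba Na Nb Qb.
  - have -> : a = b by apply: (pcan_inj pickleK).
    by rewrite bracketxx //; exact: word_poly0.
elim/GP_ind: u; elim=> [x|||t IH|a t IH|s IHs t IHt|s IHs t IHt|s IHs t IHt].
- by rewrite GP_liftE; exact: Pv.
- by rewrite GP_liftE; exact: word_poly0.
- by rewrite GP_liftE -(scale1r (term_eval _ _)); exact: WPConst.
- by rewrite pi_GPN raddfN; exact: word_polyN.
- by rewrite pi_GPZ linearZ; exact: word_poly_scale.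
- by rewrite pi_GPD raddfD; exact: WPAdd.
- by rewrite pi_GPM rmorphM; exact: WPMul.
- by rewrite pi_GPB GP_lift_bracket; exact: word_poly_bracket.
Qed.

Lemma GP_lift_id (u : GP K Y) : GP_lift (GP_gen K) u = u.
Proof. by rewrite -(@GP_lift_unique _ _ _ (GP_gen K) idfun). Qed.

Lemma word_poly_finite P u : word_poly P u ->
  exists s : seq word,
    (forall w, w \in s -> P w) /\ word_poly (fun w => w \in s) u.
Proof.
have cat_l s s' v :
    word_poly (fun w => w \in s) v -> word_poly (fun w => w \in s ++ s') v.
  by apply: word_poly_mono => w ws; rewrite mem_cat ws.
have cat_r s s' v :
    word_poly (fun w => w \in s') v -> word_poly (fun w => w \in s ++ s') v.
  by apply: word_poly_mono => w ws; rewrite mem_cat ws orbT.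
elim=> [a|w Pw|v v' _ [s [Ps Sv]] _ [s' [Ps' Sv']]
  |v v' _ [s [Ps Sv]] _ [s' [Ps' Sv']]].
- by exists [::]; split=> //; exact: WPConst.
- exists [:: w]; split=> [w'|]; first by rewrite mem_seq1 => /eqP->.
  by apply: WPWord; rewrite mem_seq1.
- exists (s ++ s'); split=> [w|]; first by rewrite mem_cat => /orP[/Ps|/Ps'].
  by apply: WPAdd; [exact: cat_l | exact: cat_r].
- exists (s ++ s'); split=> [w|]; first by rewrite mem_cat => /orP[/Ps|/Ps'].
  by apply: WPMul; [exact: cat_l | exact: cat_r].
Qed.

Lemma word_poly_mpoly (P : word -> Prop) n (s : n.-tuple word) u :
    (forall w, P w -> w \in s) -> word_poly P u ->
  exists G : {mpoly K[n]},
    u = mmap (GRing.in_alg (GP K Y)) (word_eval \o tnth s) G /\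
    forall i, ~ P (tnth s i) -> G^`M(i) = 0.
Proof.
move=> Ps; elim=> [a|w Pw|v v' _ [G [-> dG]] _ [G' [-> dG']]
  |v v' _ [G [-> dG]] _ [G' [-> dG']]].
- by exists a%:MP; split=> [|i _]; rewrite ?mmapC ?mderivC.
- have /tnthP[k def_w] := Ps w Pw; exists 'X_k; split=> [|i Pi].
    by rewrite mmapX mmap1U /= -def_w.
  rewrite mderivU; case: eqP => // ik; by case: Pi; rewrite ik -def_w.
- by exists (G + G'); split=> [|i Pi]; rewrite ?mmapD ?mderivD ?dG ?dG' ?addr0.
- exists (G * G'); split=> [|i Pi]; first by rewrite rmorphM.
  by rewrite mderivM dG // dG' // mul0r mulr0 addr0.
Qed.

Lemma mmap_word_poly (P : word -> Prop) n (h : 'I_n -> GP K Y) (G : {mpoly K[n]}) :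
  (forall i, word_poly P (h i)) ->
  word_poly P (mmap (GRing.in_alg (GP K Y)) h G).
Proof.
move=> Ph; elim/mpoly_ring_ind: G => [a|i|G G' PG PG'|G G' PG PG'].
- by rewrite mmapC; exact: WPConst.
- by rewrite mmapX mmap1U.
- by rewrite mmapD; exact: WPAdd.
- by rewrite rmorphM; exact: WPMul.
Qed.

End Evaluation.
End Words.

(** * Solving an equation for one bracket word *)

Section SolvingWord.
Variables (K : fieldType) (Y : countType) (n : nat) (s : n.-tuple (word Y)).
Hypotheses (charK0 : [pchar K] =i pred0) (s_uniq : uniq s).
Hypotheses (s_normal : forall w, w \in s -> normal w).
Hypotheses (s_sub : forall a b, Node a b \in s -> (a \in s) && (b \in s)).
Local Notation ev G :=
  (mmap (GRing.in_alg (GP K Y)) (@word_eval Y K \o tnth s) G).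

(** The condition on [F] says that the word solved for is not a proper subword of
    a word of [F]: the values of the words that contain it are not under control.
    This is why it has to be chosen of maximal size. *)
Lemma solve_word (F : {mpoly K[n]}) (j : 'I_n) : F^`M(j) != 0 ->
    (forall k, F^`M(k) != 0 -> tnth s j \notin behead (subwords (tnth s k))) ->
  exists (A : gpAlgType K) (v : Y -> A),
    GP_lift v (ev F) = 0 /\
    forall G, (forall k, G^`M(k) != 0 -> tnth s j \notin subwords (tnth s k)) ->
      GP_lift v (ev G) = 0 -> G = 0.
Proof.
move=> dF0 Fj.
have [L [iota [t [z [d [der_d d_iota d_t t_inj tF0]]]]]] :=
  generic_root (@tofrac_inj {mpoly K[n]}) (@tofrac_surj _) dF0.
pose tau k := if k == j then z else t k.
pose node p q k := (tnth s k == Node (tnth s p) (tnth s q))%:R : L.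
(* Normality of [s] ensures that the two terms of a coefficient never cancel:
   at most one of the two bracketings of a pair of words belongs to [s]. *)
pose c p q := \sum_k (node p q k - node q p k) * tau k.
have cC p q : c p q = - c q p.
  by rewrite /c -sumrN; apply: eq_bigr => k _; rewrite -mulNr opprB.
pose B := Bivector der_d d_iota cC; pose A : gpAlgType K := bv_alg B.
pose v y : A := \sum_k (tnth s k == Leaf y)%:R * tau k.
have sum_tau k w : tnth s k = w -> \sum_i (tnth s i == w)%:R * tau i = tau k.
  move=> <-; rewrite (bigD1 k) //= eqxx mul1r big1 ?addr0 // => i ik.
  by rewrite (inj_eq (tuple_uniqP _ s_uniq)) (negPf ik) mul0r.
have lift_word w k : tnth s k = w -> tnth s j \notin behead (subwords w) ->
    GP_lift v (word_eval K w) = tau k.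
  elim: w k => [y|a IHa b IHb] k def_w.
    by rewrite GP_lift_gen => _; exact: sum_tau.
  have ws : Node a b \in s by rewrite -def_w mem_tnth.
  have /and3P[ab _ _] := s_normal ws.
  have /andP[/tnthP[p def_a] /tnthP[q def_b]] := s_sub ws.
  rewrite /= mem_cat negb_or => /andP[ja jb].
  have sub_behead c' :
      tnth s j \notin subwords c' -> tnth s j \notin behead (subwords c').
    by apply: contra; exact: mem_behead.
  have tau_t i c' : c' = tnth s i -> tnth s j \notin subwords c' -> tau i = t i.
    by move=> ->; rewrite /tau; case: eqP => // ->; rewrite subwords_refl.
  rewrite GP_lift_bracket (IHa p) ?(IHb q) ?sub_behead //.
  rewrite (tau_t p a) // (tau_t q b) //.
  rewrite (bv_bracket_coordinates (B := B) (t := t)) //=.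
  rewrite /c (eq_bigr (fun i => (tnth s i == Node a b)%:R * tau i)) => [|i _].
    exact: sum_tau.
  rewrite /node -def_a -def_b.
  suff /negPf-> : tnth s i != Node b a by rewrite subr0.
  apply: contraL ab => /eqP si; rewrite -leqNgt ltnW //.
  by have := s_normal (mem_tnth i s); rewrite si => /and3P[].
have lift_ev G : GP_lift v (ev G) =
    mmap (GRing.in_alg A) (GP_lift v \o @word_eval Y K \o tnth s) G.
  by apply: rmorph_mmap => a /=; rewrite linearZ rmorph1.
have iota_alg h G : mmap (GRing.in_alg A) h G = mmap iota h G :> L.
  by apply: eq_bigr => m _; congr (_ * _); exact: (bv_in_alg B G@_m).
exists A, v; split=> [|G Gj].
  rewrite lift_ev (@eq_mmap_mderiv _ _ A _ _ tau) // => [|k /Fj].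
    by rewrite iota_alg.
  exact: lift_word.
rewrite lift_ev (@eq_mmap_mderiv _ _ A _ _ t) // => [|k /Gj jk /=].
  by rewrite iota_alg; exact: t_inj.
rewrite (lift_word _ k) //.
  by rewrite /tau; case: eqP jk => // ->; rewrite subwords_refl.
by apply: contra jk; exact: mem_behead.
Qed.

End SolvingWord.

(** * The theorem *)

Section Range.
Variables (K : fieldType) (X : countType).
Local Notation GPx := (GP K (option X)).
Local Notation map := (GP_map K (@Some X)).

Lemma word_poly_range (u : GPx) : word_poly (letters_in isSome) u -> range map u.
Proof.
have wordR w : letters_in isSome w -> range map (word_eval K w).
  elim: w => [[y|//] _|a IHa b IHb /= /andP[/IHa[u' _ <-] /IHb[v' _ <-]]].
    by exists (GP_gen K y) => //; rewrite /GP_map GP_lift_gen.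
  by exists (bracket u' v') => //; rewrite /GP_map GP_lift_bracket.
elim=> [a|w /wordR//|_ _ _ [u' _ <-] _ [v' _ <-]
  |_ _ _ [u' _ <-] _ [v' _ <-]].
- by exists a%:A => //; rewrite /GP_map linearZ rmorph1.
- by exists (u' + v') => //; rewrite /GP_map rmorphD.
- by exists (u' * v') => //; rewrite /GP_map rmorphM.
Qed.

End Range.

Theorem theorem3 (K : fieldType) (charK0 : [pchar K] =i pred0)
    (f : GP K (option nat)) (fX : ~ range (GP_map K (@Some nat)) f) :
  ideal_gen f `&` range (GP_map K (@Some nat)) = [set 0].
Proof.
have idf := gp_ideal_gen f.
apply/seteqP; split=> [g [fg rg]|_ ->]; last first.
  by split; [exact: gp_ideal0 | exists 0 => //; rewrite /GP_map rmorph0].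
have [sf [Psf wf]] : exists s : seq (word (option nat)),
    (forall w, w \in s -> normal w && letters_in predT w) /\
    word_poly (fun w => w \in s) f.
  apply: word_poly_finite; rewrite -(GP_lift_id f).
  by apply: word_poly_lift => // y; apply: (@WPWord _ _ _ (Leaf y)).
have [sg [Psg wg]] : exists s : seq (word (option nat)),
    (forall w, w \in s -> normal w && letters_in isSome w) /\
    word_poly (fun w => w \in s) g.
  apply: word_poly_finite; case: rg => g' _ <-.
  by apply: word_poly_lift => // y; apply: (@WPWord _ _ _ (Leaf (Some y))).
(* A common finite supply of words for [f] and [g], closed under subwords so that
   the value of a word can be computed by recursion inside it. *)
pose S := undup (flatten [seq subwords w | w <- sf ++ sg]).
have S_normal w : w \in S -> normal w.
  rewrite mem_undup => /flatten_mapP[w' w's]; apply: subwords_normal.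
  by move: w's; rewrite mem_cat => /orP[/Psf|/Psg] /andP[].
have S_sub a b : Node a b \in S -> (a \in S) && (b \in S).
  rewrite !mem_undup => /flatten_mapP[w' w's /subwords_node/andP[aw bw]].
  by apply/andP; split; apply/flatten_mapP; exists w'.
have sub_S w : w \in sf ++ sg -> w \in S.
  by move=> ws; rewrite mem_undup; apply/flatten_mapP;
    exists w; rewrite ?subwords_refl.
pose s := in_tuple S.
have [F [def_f _]] : exists F : {mpoly K[size S]},
    f = mmap (GRing.in_alg _) (@word_eval _ K \o tnth s) F /\
    forall i, ~ (tnth s i \in sf) -> F^`M(i) = 0.
  by apply: (word_poly_mpoly (s := s) _ wf) => w ws;
    apply: sub_S; rewrite mem_cat ws.
have [G [def_g dG]] : exists G : {mpoly K[size S]},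
    g = mmap (GRing.in_alg _) (@word_eval _ K \o tnth s) G /\
    forall i, ~ (tnth s i \in sg) -> G^`M(i) = 0.
  apply: (word_poly_mpoly (s := s) _ wg) => w ws.
  by apply: sub_S; rewrite mem_cat ws orbT.
pose occurs k := (F^`M(k) != 0) && ~~ letters_in isSome (tnth s k).
have [k0 k0F] : exists k, occurs k.
  apply/not_existsP => noF; apply: fX; apply: word_poly_range.
  (* No word that involves [x] occurs, so these words may be replaced by zero. *)
  rewrite def_f (@eq_mmap_mderiv _ _ _ _ _ (fun k =>
    if letters_in isSome (tnth s k) then word_eval K (tnth s k) else 0)) //
    => [|k dFk]; last first.
    by have := noF k; rewrite /occurs dFk /=; case: letters_in => // /(_ isT).
  apply: mmap_word_poly => k; case: ifP => [kX|_]; last exact: word_poly0.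
  exact: WPWord.
pose j := [arg max_(k > k0 | occurs k) word_size (tnth s k)].
have [j_occ j_max] : occurs j /\
    forall k, occurs k -> (word_size (tnth s k) <= word_size (tnth s j))%N.
  by rewrite /j; case: arg_maxnP.
have /andP[dFj jX] := j_occ.
have [|A [v [fA0 A_inj]]] :=
  solve_word charK0 (s := s) (undup_uniq _) S_normal S_sub dFj.
  move=> k dFk; have [kX|kX] := boolP (letters_in isSome (tnth s k)).
    by apply: contra jX => /mem_behead; exact: subwords_over.
  by apply/negP => /subwords_size; rewrite ltnNge j_max // /occurs dFk.
have gA0 : GP_lift v g = 0.
  have : gp_ideal [set u : GP K (option nat) | GP_lift v u = 0].
    split=> [|a u w /= u0 w0|u w /= w0|u w /= w0].
    - exact: rmorph0.
    - by rewrite raddfD /= linearZ /= u0 w0 scaler0 addr0.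
    - by rewrite rmorphM /= w0 mulr0.
    - by rewrite GP_lift_bracket w0 bracketr0.
  move=> idA; apply: (fg [set u | GP_lift v u = 0]); split=> // u ->.
  by rewrite /= def_f.
rewrite /= def_g (A_inj G) ?rmorph0 // -?def_g // => k dGk.
apply: contra jX; apply: subwords_over.
have : tnth s k \in sg by apply: contraNT dGk => /negP/dG/eqP.
by move=> /Psg/andP[].
Qed.
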